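(* Let $C\subseteq [0,1]^n$ be any closed, convex set. Let $S=\mathbb{Z}^n$ and let $\mathcal{D}$ be the family of variable disjunctions. Let $\langle c, x \rangle \leq \gamma$ be a valid inequality for $C \cap \{0,1\}^n$ (possibly $c=0$, $\gamma = -1$ if $C \cap \{0,1\}^n = \emptyset$). If there exists a branch-and-cut proof of size $N$ based on $\mathcal{D}$ (with respect to $C\cap S$) that certifies $\langle c, x \rangle \leq \gamma$, then for any $\epsilon > 0$ there exists a cutting plane proof based on $\mathcal{D}$ (with respect to $C\cap S$) of size at most $N$ certifying $\langle c, x \rangle \leq \gamma + \epsilon$. If $C$ is a polytope, then the statement is also true with $\epsilon = 0$.
   Context: A disjunction covering (valid for) a closed set $S\subseteq\mathbb{R}^n$ is a finite union $D=Q_1\cup\dots\cup Q_k$ of closed convex sets with $S\subseteq D$. The variable disjunctions are $D_{i,K}=\{x\in\mathbb{R}^n: x_i\le K\}\cup\{x\in\mathbb{R}^n: x_i\ge K+1\}$ for $i\in\{1,\dots,n\}$, $K\in\mathbb{Z}$. A cutting plane for a convex set $C$ derived from a disjunction $D$ is a halfspace $H$ with $C\cap D\subseteq H$. Cutting plane (CP) proof: for an inequality $\langle c,x\rangle\le\gamma$ valid for $C\cap S$, a CP proof based on $\mathcal{D}$ with respect to $C\cap S$ of length (size) $N$ is a sequence of halfspaces $H_1,\dots,H_N$ for which there are $D_1,\dots,D_N\in\mathcal{D}$ such that for each $i=0,\dots,N-1$, $H_{i+1}$ is a cutting plane derived from $D_{i+1}$ for $C_i:=C\cap\bigcap_{j=1}^{i}H_j$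 (with $C_0=C$), and $\langle c,x\rangle\le\gamma$ is valid for all points of $C_N$. Branch-and-cut (BC) proof: a BC proof of $\langle c,x\rangle\le\gamma$ based on $\mathcal{D}$ with respect to $C\cap S$ is a rooted tree such that: every node represents a convex subset of $C$; the root represents $C$; every non-leaf node is labeled cutting or branching; a cutting node representing $C'$ has exactly one child, which represents $C'\cap H$ for some cutting plane $H$ for $C'$ derived from some $D\in\mathcal{D}$; for a branching node representing $C'$ there is $D=Q_1\cup\dots\cup Q_k\in\mathcal{D}$ such that its children represent $C'\cap Q_1,\dots,C'\cap Q_k$; and $\langle c,x\rangle\le\gamma$ is valid for all sets represented by leaves. Its size is the number of nodes of the tree minus 1. A BC proof in which all non-leaf nodes are cutting nodes is a CP proof, and size coincides with length. *)

(* Defs.v *)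
From HB Require Import structures.
From mathcomp Require Import all_boot all_order all_algebra.
From mathcomp Require Import all_classical all_reals all_analysis.

Set Implicit Arguments.
Unset Strict Implicit.
Unset Printing Implicit Defensive.

Import Order.TTheory GRing.Theory Num.Theory.
Import numFieldNormedType.Exports.

Local Open Scope classical_set_scope.
Local Open Scope ring_scope.

Definition dot (R : realType) (n : nat) (c x : 'rV[R]_n) : R :=
  \sum_(i < n) c ord0 i * x ord0 i.

Definition valid_ineq (R : realType) (n : nat) (c : 'rV[R]_n) (gamma : R)
    (A : set 'rV[R]_n) : Prop :=
  forall x, A x -> dot c x <= gamma.

(* The normal vector of a halfspace is nonzero; a valid inequality
   [valid_ineq c gamma A] may have [c = 0]. *)
Definition halfspace (R : realType) (n : nat) (H : set 'rV[R]_n) : Prop :=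
  exists (a : 'rV[R]_n) (b : R), a != 0 /\ H = [set x | dot a x <= b].

Definition polyhedron (R : realType) (n : nat) (C : set 'rV[R]_n) : Prop :=
  exists (m : nat) (a : 'I_m -> 'rV[R]_n) (b : 'I_m -> R),
    C = [set x | forall j, dot (a j) x <= b j].

Definition polytope (R : realType) (n : nat) (C : set 'rV[R]_n) : Prop :=
  polyhedron C /\ bounded_set C.

Definition unit_cube (R : realType) (n : nat) : set 'rV[R]_n :=
  [set x | forall i, 0 <= x ord0 i <= 1].

Definition binary_points (R : realType) (n : nat) : set 'rV[R]_n :=
  [set x | forall i, x ord0 i = 0 \/ x ord0 i = 1].

Definition integer_points (R : realType) (n : nat) : set 'rV[R]_n :=
  [set x | forall i, x ord0 i \is a Num.int].

(* A disjunction is kept as its list of pieces Q_1, ..., Q_k rather than as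
   their union, since branching depends on the pieces. *)
Record disjunction (R : realType) (n : nat) (S : set 'rV[R]_n) := Disjunction {
  pieces : seq (set 'rV[R]_n);
  pieces_closed : forall Q, Q \in pieces -> closed Q;
  pieces_convex : forall Q, Q \in pieces -> @convex_set R 'rV[R]_n Q;
  pieces_cover : S `<=` [set x | exists2 Q, Q \in pieces & Q x]
}.

Definition disj_union (R : realType) (n : nat) (S : set 'rV[R]_n)
    (D : disjunction S) : set 'rV[R]_n :=
  [set x | exists2 Q, Q \in pieces D & Q x].

Section VariableDisjunction.
Variables (R : realType) (n : nat) (i : 'I_n) (K : int).

Definition var_pieces : seq (set 'rV[R]_n) :=
  [:: [set x : 'rV[R]_n | x ord0 i <= K%:~R];
      [set x : 'rV[R]_n | (K + 1)%:~R <= x ord0 i]].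

Lemma var_pieces_closed Q : Q \in var_pieces -> closed Q.
Proof.
have cont : continuous (fun x : 'rV[R]_n => x ord0 i) by exact: coord_continuous.
rewrite !inE => /orP[] /eqP->.
- by apply: (@preimage_closed _ _ _ [set y : R | y <= K%:~R]);
    [move=> x _; exact: cont | exact: closed_le].
- by apply: (@preimage_closed _ _ _ [set y : R | (K + 1)%:~R <= y]);
    [move=> x _; exact: cont | exact: closed_ge].
Qed.

Lemma var_pieces_convex Q : Q \in var_pieces -> @convex_set R 'rV[R]_n Q.
Proof.
have split_t (t : {i01 R}) (z : R) : z = t%:num * z + (1 - t%:num) * z.
  by rewrite -mulrDl addrC subrK mul1r.
rewrite !inE => /orP[] /eqP-> x y t; rewrite !in_setE => hx hy.
- suff : t%:num * x ord0 i + (1 - t%:num) * y ord0 i <= K%:~R.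
    by move=> h; rewrite /= !mxE.
  by rewrite [leRHS](split_t t) lerD// ler_wpM2l.
- suff : (K + 1)%:~R <= t%:num * x ord0 i + (1 - t%:num) * y ord0 i.
    by move=> h; rewrite /= !mxE.
  by rewrite [leLHS](split_t t) lerD// ler_wpM2l.
Qed.

Lemma var_pieces_cover : @integer_points R n `<=`
  [set x | exists2 Q, Q \in var_pieces & Q x].
Proof.
move=> x /(_ i) /intrP[m xm]; have [mK|Km] := leP m K.
- exists [set x : 'rV[R]_n | x ord0 i <= K%:~R]; first by rewrite !inE eqxx.
  by rewrite /= xm ler_int.
- exists [set x : 'rV[R]_n | (K + 1)%:~R <= x ord0 i]; first by rewrite !inE eqxx orbT.
  by rewrite /= xm ler_int lezD1.
Qed.

Definition var_disjunction : disjunction (@integer_points R n) :=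
  Disjunction var_pieces_closed var_pieces_convex var_pieces_cover.

End VariableDisjunction.

Definition variable_disjunctions (R : realType) (n : nat) :
    set (disjunction (@integer_points R n)) :=
  [set D | exists (i : 'I_n) (K : int), D = var_disjunction R i K].

Definition cutting_plane (R : realType) (n : nat) (S C : set 'rV[R]_n)
    (D : disjunction S) (H : set 'rV[R]_n) : Prop :=
  halfspace H /\ C `&` disj_union D `<=` H.

Definition cp_relaxation (R : realType) (n N : nat) (C : set 'rV[R]_n)
    (H : 'I_N -> set 'rV[R]_n) (k : nat) : set 'rV[R]_n :=
  C `&` \bigcap_(j in [set j : 'I_N | (j < k)%N]) H j.

(* The halfspaces and disjunctions are indexed from 0. *)
Definition cp_proof (R : realType) (n : nat) (S : set 'rV[R]_n)
    (DD : set (disjunction S)) (C : set 'rV[R]_n) (c : 'rV[R]_n) (gamma : R)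
    (N : nat) (H : 'I_N -> set 'rV[R]_n) : Prop :=
  [/\ valid_ineq c gamma (C `&` S),
      exists D : 'I_N -> disjunction S, forall i : 'I_N,
        DD (D i) /\ cutting_plane (cp_relaxation C H i) (D i) (H i)
    & valid_ineq c gamma (cp_relaxation C H N)].

(* Each node carries the set it represents. *)
Inductive bc_tree (R : realType) (n : nat) : Type :=
| Leaf of set 'rV[R]_n
| Cutting of set 'rV[R]_n & bc_tree R n
| Branching of set 'rV[R]_n & seq (bc_tree R n).

Definition root_set (R : realType) (n : nat) (t : bc_tree R n) : set 'rV[R]_n :=
  match t with Leaf A => A | Cutting A _ => A | Branching A _ => A end.

Fixpoint bc_nodes (R : realType) (n : nat) (t : bc_tree R n) :
    seq (set 'rV[R]_n) :=
  match t with
  | Leaf A => [:: A]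
  | Cutting A t' => A :: bc_nodes t'
  | Branching A ts => A :: flatten (map (@bc_nodes R n) ts)
  end.

Fixpoint bc_leaves (R : realType) (n : nat) (t : bc_tree R n) :
    seq (set 'rV[R]_n) :=
  match t with
  | Leaf A => [:: A]
  | Cutting _ t' => bc_leaves t'
  | Branching _ ts => flatten (map (@bc_leaves R n) ts)
  end.

Definition bc_size (R : realType) (n : nat) (t : bc_tree R n) : nat :=
  (size (bc_nodes t)).-1.

(* The children of a branching node are listed in the order of the pieces. *)
Fixpoint bc_steps (R : realType) (n : nat) (S : set 'rV[R]_n)
    (DD : set (disjunction S)) (t : bc_tree R n) : Prop :=
  match t with
  | Leaf _ => True
  | Cutting A t' =>
      (exists (D : disjunction S) (H : set 'rV[R]_n),
         [/\ DD D, cutting_plane A D H & root_set t' = A `&` H]) /\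
      bc_steps DD t'
  | Branching A ts =>
      (exists D : disjunction S,
         DD D /\ map (@root_set R n) ts = [seq A `&` Q | Q <- pieces D]) /\
      foldr and True (map (bc_steps DD) ts)
  end.

Definition bc_proof (R : realType) (n : nat) (S : set 'rV[R]_n)
    (DD : set (disjunction S)) (C : set 'rV[R]_n) (c : 'rV[R]_n) (gamma : R)
    (t : bc_tree R n) : Prop :=
  [/\ valid_ineq c gamma (C `&` S),
      root_set t = C,
      forall A, A \in bc_nodes t -> @convex_set R 'rV[R]_n A /\ A `<=` C,
      bc_steps DD t
    & forall A, A \in bc_leaves t -> valid_ineq c gamma A].

(* Main.v *)
Require Import Defs.
From mathcomp Require Import all_boot all_order all_algebra.
From mathcomp Require Import all_classical all_reals all_analysis.
From mathcomp Require Import ring lra zify.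

(** Branching on [x_i] inside the unit cube only ever produces faces: if
    [C] lies in the cube, then [x_i <= 0] and [x_i >= 1] cut out the faces of
    [C] on which [- x_i <= 0] and [x_i <= 1] are tight, while a branching with
    [K <> 0] leaves [C] unchanged on one of its two sides.  So it is enough to
    know that a cutting plane proof that lives on a face [F] of [C] can be
    carried out on [C] itself, with as many cuts, in such a way that the set
    which it produces meets the hyperplane of [F] only where the inequality
    holds ([lift_face]).  Given this, a branching node is replaced by the
    lifted proof of its first child, then the lifted proof of its second
    child, then a single cut by the target inequality itself: by then the
    inequality holds on both faces, hence it is a cut for the disjunction on
    [x_i] ([branch_step]).  This takes [N1 + N2 + 1] cuts for a subtree of size
    [N1 + N2 + 2], and induction on the tree concludes ([bc_certifies]).

    A cut [<a, x> <= b] for the face [F = C /\ {<e, x> = beta}], where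
    [<e, x> <= beta] on [C], is lifted by tilting it around [F]: for [M] large
    the inequality [<a, x> + M (<e, x> - beta) <= b] restricts to the given cut
    on the hyperplane, and off the hyperplane the term in [M] makes it hold on
    the pieces of [C] selected by the disjunction.  Whether a finite [M] exists
    is where the two parts of the theorem differ.  For a polytope it is a
    Lagrange multiplier, given by the Farkas lemma ([tilt_polyhedron]).  For a
    compact set it exists once [b] has been increased by some [eta > 0]
    ([tilt_compact]).  The remaining cuts on [F] are then applied to a set
    slightly larger than planned, so one needs that a cutting plane proof is
    stable: if it works for a compact set, then for every [eps > 0] a proof
    with as many cuts and right-hand side increased by [eps] works for all
    sets in some neighbourhood of it ([certifies_near]).

    Both parts are handled at once by carrying the alternative that the slack
    [eps] is positive or the set is a polyhedron ([liftable]). *)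

Set Implicit Arguments.
Unset Strict Implicit.
Unset Printing Implicit Defensive.

Import Order.TTheory GRing.Theory Num.Theory.
Import numFieldNormedType.Exports.

Local Open Scope classical_set_scope.
Local Open Scope ring_scope.

(** * The Farkas lemma *)

(** Bartl's induction on the number of functionals.  If the last one, [f_0],
    is needed, some [x0] satisfies the other constraints and has [g x0 > 0], so
    [f_0 x0 > 0]; projecting along [x0] onto the kernel of [f_0] removes [f_0]
    from the hypothesis, and the coefficient of [f_0] recovered from the
    projected identity is nonnegative by the signs at [x0]. *)
Lemma farkas (F : realFieldType) (V : lmodType F) (m : nat)
    (f : 'I_m -> V -> F) (g : V -> F) :
  (forall i, scalar (f i)) -> scalar g ->
  (forall x, (forall i, f i x <= 0) -> g x <= 0) ->
  exists u : 'I_m -> F,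
    (forall i, 0 <= u i) /\ forall x, g x = \sum_(i < m) u i * f i x.
Proof.
elim: m f g => [|m IHm] f g f_lin g_lin fg.
  have g_le0 x : g x <= 0 by apply: fg => -[].
  exists (fun _ => 0); split=> // x; rewrite big_ord0.
  apply/eqP; rewrite eq_le g_le0 /=.
  (* g (- x) <= 0 as well, where - x is written -2 *: x + x *)
  have gNx := g_lin (-2) x x.
  by have := g_le0 (-2 *: x + x); lra.
pose f' i := f (lift ord0 i).
have [fg'|] := pselect (forall x, (forall i, f' i x <= 0) -> g x <= 0).
  have [u [u_ge0 gE]] := IHm f' g (fun i => f_lin _) g_lin fg'.
  exists (fun i => oapp u 0 (unlift ord0 i)); split=> [i|x].
    by case: unliftP => [j _|_] /=.
  rewrite big_ord_recl unlift_none /= mul0r add0r gE.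
  by apply: eq_bigr => i _; rewrite liftK.
move=> /existsNP[x0 /not_implyP[f'x0 /negP]]; rewrite -ltNge => gx0.
have f0x0 : 0 < f ord0 x0.
  rewrite ltNge; apply/negP => f0x0; move: gx0; rewrite ltNge => /negP; apply.
  by apply: fg => i; case: (unliftP ord0 i) => [j ->|-> //]; exact: f'x0.
set s := (f ord0 x0)^-1; have s_gt0 : 0 < s by rewrite invr_gt0.
pose pr (h : V -> F) x := h x - s * h x0 * f ord0 x.
have prE (h : V -> F) x : scalar h -> pr h x = h (- (s * f ord0 x) *: x0 + x).
  by move=> h_lin; rewrite h_lin /pr; ring.
have pr_lin h : scalar h -> scalar (pr h).
  by move=> h_lin a x y; rewrite /pr h_lin (f_lin ord0); ring.
have [|u [u_ge0 gE]] := IHm (fun i => pr (f' i)) (pr g)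
    (fun i => pr_lin _ (f_lin _)) (pr_lin _ g_lin).
  move=> x prx; rewrite prE //; apply: fg => i.
  case: (unliftP ord0 i) => [j ->|->]; first by rewrite -prE //; exact: prx.
  rewrite (f_lin ord0) mulNr mulrAC /s mulVf ?gt_eqF // mul1r.
  by rewrite addNr.
pose u0 := s * (g x0 - \sum_(i < m) u i * f' i x0).
exists (fun i => oapp u u0 (unlift ord0 i)); split=> [i|x].
  case: unliftP => [j _|_] /=; first exact: u_ge0.
  apply: mulr_ge0; first exact: ltW.
  rewrite subr_ge0 (le_trans _ (ltW gx0)) //.
  by apply: sumr_le0 => j _; apply: mulr_ge0_le0.
rewrite big_ord_recl unlift_none /=.
under eq_bigr do rewrite liftK /=.
rewrite -[X in _ = _ + X]/(\sum_(i < m) u i * f' i x).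
have -> : g x = \sum_(i < m) u i * pr (f' i) x + s * g x0 * f ord0 x.
  by rewrite -gE /pr subrK.
have -> : \sum_(i < m) u i * pr (f' i) x = \sum_(i < m) u i * f' i x -
    s * f ord0 x * \sum_(i < m) u i * f' i x0.
  rewrite mulr_sumr -sumrB; apply: eq_bigr => i _; rewrite /pr; ring.
by rewrite /u0; ring.
Qed.

(** * Linear forms and their level sets *)

Section Dot.
Context {R : realType} {n : nat}.
Implicit Types (a b x y : 'rV[R]_n) (k : R).

Lemma dotDl a b x : dot (a + b) x = dot a x + dot b x.
Proof. by rewrite /dot -big_split; apply: eq_bigr => i _; rewrite mxE mulrDl. Qed.

Lemma dotZl k a x : dot (k *: a) x = k * dot a x.
Proof. by rewrite /dot mulr_sumr; apply: eq_bigr => i _; rewrite mxE mulrA. Qed.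

Lemma dot_linear a : scalar (dot a).
Proof.
move=> k x y; rewrite /dot mulr_sumr -big_split; apply: eq_bigr => i _ /=.
by rewrite !mxE mulrDr mulrCA.
Qed.

Lemma dot0l x : dot 0 x = 0 :> R.
Proof. by rewrite -(scale0r 0) dotZl mul0r. Qed.

Lemma dotNl a x : dot (- a) x = - dot a x.
Proof. by rewrite -scaleN1r dotZl mulN1r. Qed.

Lemma dotZr k a x : dot a (k *: x) = k * dot a x.
Proof. by rewrite /dot mulr_sumr; apply: eq_bigr => i _; rewrite mxE mulrCA. Qed.

Lemma dot_delta i x : dot (delta_mx 0 i) x = x ord0 i.
Proof.
rewrite /dot (bigD1 i) //= mxE !eqxx mul1r big1 ?addr0 // => j ji.
by rewrite mxE (negPf ji) andbF mul0r.
Qed.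

Lemma dot_continuous a : continuous (dot a : 'rV[R]_n -> R).
Proof.
apply: continuous_big => [|i _ x]; first exact: (@add_continuous R^o).
apply: (continuous_comp (g := *%R (a ord0 i))).
  exact: coord_continuous.
exact: mulrl_continuous.
Qed.

End Dot.

Section LevelSets.
Context {R : realType} {n : nat}.
Implicit Types (a e : 'rV[R]_n) (b beta : R).

Definition sublevel a b : set 'rV[R]_n := [set x | dot a x <= b].
Definition hyperplane e beta : set 'rV[R]_n := [set x | dot e x = beta].

Lemma sublevel_closed a b : closed (sublevel a b).
Proof.
by apply: (@preimage_closed _ _ (dot a) [set y | y <= b]) => // x _;
  exact: dot_continuous.
Qed.

Lemma superlevel_closed a b : closed [set x | b <= dot a x].
Proof.
by apply: (@preimage_closed _ _ (dot a) [set y | b <= y]) => [x _|];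
  [exact: dot_continuous | exact: closed_ge].
Qed.

Lemma strict_sublevel_open a b : open [set x : 'rV[R]_n | dot a x < b].
Proof.
by apply: (@open_comp _ _ (dot a) [set y | y < b]) => // x _;
  exact: dot_continuous.
Qed.

Lemma strict_superlevel_open a b : open [set x : 'rV[R]_n | b < dot a x].
Proof.
by apply: (@open_comp _ _ (dot a) [set y | b < y]) => [x _|];
  [exact: dot_continuous | exact: open_gt].
Qed.

Lemma hyperplane_closed e beta : closed (hyperplane e beta).
Proof.
have -> : hyperplane e beta = sublevel e beta `&` [set x | beta <= dot e x].
  apply/seteqP; split=> x /=; rewrite /hyperplane /sublevel /=; first by move=> ->.
  move=> [h1 h2].
  by apply/eqP; rewrite eq_le h1 h2.
by apply: closedI; [exact: sublevel_closed | exact: superlevel_closed].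
Qed.

Lemma sublevel_polyhedron a b : polyhedron (sublevel a b).
Proof.
exists 1%N, (fun=> a), (fun=> b).
by apply/seteqP; split=> x /= => [h _ //|h]; exact: h ord0.
Qed.

Lemma polyhedronI (A1 A2 : set 'rV[R]_n) : polyhedron A1 -> polyhedron A2 ->
  polyhedron (A1 `&` A2).
Proof.
move=> [m1 [a1 [b1 ->]]] [m2 [a2 [b2 ->]]].
exists (m1 + m2)%N,
  (fun j => match fintype.split j with inl i => a1 i | inr i => a2 i end),
  (fun j => match fintype.split j with inl i => b1 i | inr i => b2 i end).
apply/seteqP; split=> x /= => [[h1 h2] j|h].
  by case: (fintype.split j).
split=> j.
- by have := h (lshift m2 j); rewrite (unsplitK (inl j)).
- by have := h (rshift m1 j); rewrite (unsplitK (inr j)).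
Qed.

Lemma le_coordE (i : 'I_n) b :
  [set x : 'rV[R]_n | x ord0 i <= b] = sublevel (delta_mx 0 i) b.
Proof. by apply/seteqP; split=> x; rewrite /sublevel /= dot_delta. Qed.

Lemma ge_coordE (i : 'I_n) b :
  [set x : 'rV[R]_n | b <= x ord0 i] = sublevel (- delta_mx 0 i) (- b).
Proof.
by apply/seteqP; split=> x; rewrite /sublevel /= dotNl dot_delta lerN2.
Qed.

Lemma delta_neq0 (i : 'I_n) : delta_mx 0 i != 0 :> 'rV[R]_n.
Proof.
by apply/eqP => /rowP/(_ i)/eqP; rewrite !mxE !eqxx oner_eq0.
Qed.

End LevelSets.

(** * Compactness *)

Section Compactness.
Context {R : realType} {T : topologicalType}.
Implicit Types (K : set T) (f : T -> R).

Lemma compact_ubound K f : compact K -> continuous f ->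
  exists b, forall x, K x -> f x <= b.
Proof.
move=> cK cf; have [K0|/set0P K0] := eqVneq K set0.
  by exists 0 => x; rewrite K0.
have [x _ xmax] := compact_EVT_max K0 cK (continuous_subspaceT cf).
by exists (f x) => y Ky; apply: xmax; rewrite inE.
Qed.

Lemma compact_gt0 K f : compact K -> continuous f ->
  (forall x, K x -> 0 < f x) -> exists2 d, 0 < d & forall x, K x -> d <= f x.
Proof.
move=> cK cf f_gt0; have [K0|/set0P K0] := eqVneq K set0.
  by exists 1 => // x; rewrite K0.
have [x Kx xmin] := compact_EVT_min K0 cK (continuous_subspaceT cf).
exists (f x) => [|y Ky]; first by apply: f_gt0; rewrite inE in Kx.
by apply: xmin; rewrite inE.
Qed.

End Compactness.

Section CompactSets.
Context {R : realType} {n : nat}.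
Implicit Types (A K U : set 'rV[R]_n) (a : 'rV[R]_n) (b : R).

Lemma unit_cube_compact : compact (@unit_cube R n).
Proof.
have := @rV_compact R n (fun=> [set` `[0, 1]]) (fun=> @segment_compact R 0 1).
congr compact; apply/seteqP; split=> x h i; have := h i;
  by rewrite /= in_itv.
Qed.

Lemma closed_in_cube_compact A : closed A -> A `<=` @unit_cube R n -> compact A.
Proof. by move=> cA; apply: subclosed_compact => //; exact: unit_cube_compact. Qed.

(** The compact set [K] minus [U] misses the closed halfspace, so [dot a]
    stays at a positive distance above [b] on it. *)
Lemma relax_into_open K a b U : compact K -> open U ->
    K `&` sublevel a b `<=` U ->
  exists2 eta, 0 < eta & K `&` sublevel a (b + eta) `<=` U.
Proof.
move=> cK oU KU.
have cKU : compact (K `&` ~` U).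
  by apply: compact_closedI => //; exact: open_closedC.
have [||d d_gt0 dP] := compact_gt0 cKU (f := fun x => dot a x - b : R).
- by move=> x; exact: (cvgB (@dot_continuous _ _ a x) (cvg_cst b)).
- move=> x [Kx nUx]; rewrite subr_gt0 ltNge; apply/negP => ax.
  by apply: nUx; exact: KU.
exists (d / 2); first by rewrite divr_gt0.
move=> x [Kx]; rewrite /sublevel /= => ax; apply: contrapT => nUx.
by have := dP x (conj Kx nUx); lra.
Qed.

End CompactSets.

(** * Tilting an inequality around a face *)

Section Tilt.
Context {R : realType} {n : nat}.
Implicit Types (A : set 'rV[R]_n) (a e x : 'rV[R]_n) (b beta eta : R).

(** The part of [A] where [b + eta <= dot a x] is compact and disjoint from the
    hyperplane, so [beta - dot e x] is bounded away from [0] there, while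
    [dot a x - b] is bounded above. *)
Lemma tilt_compact A a b e beta eta : compact A -> 0 < eta ->
    A `<=` sublevel e beta -> A `&` hyperplane e beta `<=` sublevel a b ->
  exists2 M0, 0 <= M0 & forall M x, M0 <= M -> A x ->
    dot a x + M * (dot e x - beta) <= b + eta.
Proof.
move=> cA eta_gt0 Ae Fa.
have cK : compact (A `&` [set x | b + eta <= dot a x]).
  by apply: compact_closedI => //; exact: superlevel_closed.
have [||d d_gt0 dP] := compact_gt0 cK (f := fun x => beta - dot e x : R).
- by move=> x; exact: (cvgB (cvg_cst beta) (@dot_continuous _ _ e x)).
- move=> x [Ax ax]; rewrite subr_gt0 lt_neqAle Ae // andbT.
  apply/eqP => ex; have := Fa x (conj Ax ex); rewrite /sublevel /= in ax *; lra.
have [B BP] := compact_ubound cA (@dot_continuous _ _ a).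
exists (`|B - b| / d) => [|M x M0 Ax].
  by rewrite divr_ge0 // ltW.
have ex : dot e x <= beta := Ae _ Ax.
have M_ge0 : 0 <= M by apply: le_trans M0; rewrite divr_ge0 // ltW.
have [ax|/ltW ax] := leP (dot a x) (b + eta).
  have : 0 <= M * (beta - dot e x) by rewrite mulr_ge0 // subr_ge0.
  lra.
have : `|B - b| <= M * (beta - dot e x).
  rewrite ler_pdivrMr // in M0; apply: le_trans M0 _.
  by rewrite ler_wpM2l // dP.
have := ler_norm (B - b); have := BP _ Ax; lra.
Qed.

Lemma cube_ray_eq0 (p x : 'rV[R]_n) :
  (forall k, 0 <= k -> unit_cube (p + k *: x)) -> x = 0.
Proof.
move=> h; apply/rowP => i; rewrite mxE; apply/eqP; apply: contraT => xi_neq0.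
have := h 0 (lexx 0) i.
(* a step that moves the coordinate i by 2 leaves the cube *)
have := h (2 / `|x ord0 i|) (divr_ge0 (ler0n _ 2) (normr_ge0 _)) i.
rewrite !mxE mul0r addr0; have [xi|xi] := ltP (x ord0 i) 0.
- rewrite ltr0_norm // invrN mulrN mulNr -mulrA mulVf // mulr1; lra.
- rewrite ger0_norm // -mulrA mulVf // mulr1; lra.
Qed.

(** The multiplier is a Lagrange multiplier of the constraint
    [dot e x >= beta] in the linear program that maximizes [dot a] over the
    face.  The Farkas lemma yields it after homogenization: an affine inequality
    [dot c x <= d] becomes [dot c x - d * t <= 0] in the variables [(x, t)] with
    [t >= 0].  Points with [t > 0] rescale to points of the face, and points
    with [t = 0] are recession directions of [A], hence zero because [A] is
    bounded. *)
Lemma tilt_polyhedron A a b e beta : polyhedron A -> A `<=` @unit_cube R n ->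
    A `<=` sublevel e beta -> A `&` hyperplane e beta `<=` sublevel a b ->
  exists2 M0, 0 <= M0 & forall M x, M0 <= M -> A x ->
    dot a x + M * (dot e x - beta) <= b.
Proof.
move=> [m [r [s AE]]] Acube Ae Fa.
have [A0|/set0P[p Ap]] := eqVneq A set0.
  by exists 0 => // M x; rewrite A0.
pose homog (c : 'rV[R]_n) (d : R) (z : 'rV[R]_n * R^o) : R :=
  dot c z.1 - d * z.2.
have homog_lin c d : scalar (homog c d).
  by move=> k y z; rewrite /homog /= dot_linear /(_ *: _) /=; ring.
(* index 0 is beta * t <= dot e x, index 1 is 0 <= t, the others describe A *)
pose f (i : 'I_m.+2) : 'rV[R]_n * R^o -> R :=
  oapp (fun i' => oapp (fun j => homog (r j) (s j)) (homog 0 1) (unlift ord0 i'))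
       (homog (- e) (- beta)) (unlift ord0 i).
have f_lin i : scalar (f i).
  rewrite /f; case: unliftP => [i' _|_] /=; last exact: homog_lin.
  by case: unliftP => [j _|_] /=; exact: homog_lin.
have [|u [u_ge0 uP]] := farkas f_lin (homog_lin a b).
  move=> [x t] fx.
  have rx j : dot (r j) x <= s j * t.
    have := fx (lift ord0 (lift ord0 j)).
    by rewrite /f !liftK /= liftK /= /homog /= subr_le0.
  have t_ge0 : 0 <= t.
    have := fx (lift ord0 ord0).
    by rewrite /f liftK /= unlift_none /= /homog /= dot0l; lra.
  have ex : beta * t <= dot e x.
    have := fx ord0; rewrite /f unlift_none /= /homog /= dotNl; lra.
  rewrite /homog /= subr_le0; move: t_ge0; rewrite le_eqVlt => /orP[/eqP t0|t_gt0].
    have x0 : x = 0.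
      apply: (@cube_ray_eq0 p) => k k_ge0; apply: Acube; rewrite AE /= => j.
      rewrite addrC dot_linear.
      have := rx j; rewrite -t0 mulr0 => rx0.
      have : dot (r j) p <= s j by move: Ap; rewrite AE; apply.
      have := mulr_ge0_le0 k_ge0 rx0; lra.
    by rewrite x0 -t0 mulr0 -(scale0r 0) dotZr mul0r.
  have Ay : A (t^-1 *: x).
    by rewrite AE /= => j; rewrite dotZr mulrC ler_pdivrMr.
  have : sublevel a b (t^-1 *: x).
    apply: Fa; split=> //; apply/eqP; rewrite eq_le Ae //=.
    by rewrite dotZr mulrC ler_pdivlMr.
  by rewrite /sublevel /= dotZr mulrC ler_pdivrMr.
exists (u ord0) => // M x M0 Ax.
have := uP (x, 1); rewrite !big_ord_recl /= {1}/homog /=.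
rewrite {1 2}/f unlift_none liftK /= unlift_none /= {1 2}/homog /= dot0l dotNl.
set S := \sum_(i < m) _ => aE.
have S_le0 : S <= 0.
  apply: sumr_le0 => j _; apply: mulr_ge0_le0 => //.
  rewrite /f !liftK /= liftK /= /homog /= mulr1 subr_le0.
  by move: Ax; rewrite AE; apply.
have := u_ge0 (lift ord0 ord0).
have : 0 <= (M - u ord0) * (beta - dot e x).
  by apply: mulr_ge0; rewrite subr_ge0 //; exact: Ae.
lra.
Qed.

End Tilt.

(** * Cutting plane proofs as chains of sets *)

Section CutDown.
Context {R : realType} {n : nat} {S : set 'rV[R]_n}.
Context (DD : set (disjunction S)).
Implicit Types (A C K : set 'rV[R]_n) (a c e x : 'rV[R]_n) (N : nat).

(** [cut_down N C C'] means that at most [N] successive cuts lead from [C] to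
    [C'].  Only an upper bound on the number of cuts is recorded, because some
    branchings are simulated with fewer cuts than their size allows. *)
Inductive cut_down : nat -> set 'rV[R]_n -> set 'rV[R]_n -> Prop :=
| cut_stop N C : cut_down N C C
| cut_step N C C' (D : disjunction S) H :
    DD D -> cutting_plane C D H -> cut_down N (C `&` H) C' ->
    cut_down N.+1 C C'.

Definition certifies N C c gamma : Prop :=
  exists2 C', cut_down N C C' & valid_ineq c gamma C'.

Lemma cut_down_sub N C C' : cut_down N C C' -> C' `<=` C.
Proof. by elim=> [M B x //|M B B' D H _ _ _ IH x /IH[]]. Qed.

Lemma cut_down_leq N M C C' : (N <= M)%N -> cut_down N C C' -> cut_down M C C'.
Proof.
move=> + CC'; elim: CC' M => [{}N {}C M _|]; first exact: cut_stop.
move=> {}N {}C {}C' D H DD_D cutH _ IH [//|M] NM.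
exact: cut_step DD_D cutH (IH M NM).
Qed.

Lemma cut_down_trans N1 N2 C1 C2 C3 :
  cut_down N1 C1 C2 -> cut_down N2 C2 C3 -> cut_down (N1 + N2) C1 C3.
Proof.
elim=> [N C /cut_down_leq|N C C' D H DD_D cutH _ IH /IH CC3].
  by apply; exact: leq_addl.
exact: cut_step DD_D cutH CC3.
Qed.

Lemma cut_down_mono N A C C' : A `<=` C -> cut_down N C C' ->
  exists2 A', cut_down N A A' & A' `<=` C'.
Proof.
move=> + CC'; elim: CC' A => [{}N {}C A AC|]; first by exists A => //; exact: cut_stop.
move=> {}N {}C {}C' D H DD_D [hH CH] _ IH A AC.
have [|A' AA' A'C'] := IH (A `&` H); first exact: setSI.
exists A' => //; apply: (cut_step DD_D _ AA'); split=> // x [/AC Cx Dx].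
exact: CH.
Qed.

Lemma certifies_mono N M A C c gamma delta : (N <= M)%N -> A `<=` C ->
  gamma <= delta -> certifies N C c gamma -> certifies M A c delta.
Proof.
move=> NM AC gd [C' /(cut_down_leq NM)/(cut_down_mono AC)[A' AA' A'C'] C'v].
by exists A' => // x /A'C'/C'v cx; exact: le_trans gd.
Qed.

Lemma certifies_valid N C c gamma : valid_ineq c gamma C -> certifies N C c gamma.
Proof. by exists C; first exact: cut_stop. Qed.

Lemma certifies_cut N C (D : disjunction S) a b c gamma :
    DD D -> a != 0 -> C `&` disj_union D `<=` sublevel a b ->
  certifies N (C `&` sublevel a b) c gamma -> certifies N.+1 C c gamma.
Proof.
move=> DD_D a_neq0 CD [C' CC' C'v]; exists C' => //.
by apply: cut_step DD_D _ CC'; split=> //; exists a, b.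
Qed.

Lemma certifiesP N C c gamma : certifies N C c gamma ->
  valid_ineq c gamma C \/
  exists (N' : nat) (D : disjunction S) a b,
    [/\ N = N'.+1, DD D, a != 0, C `&` disj_union D `<=` sublevel a b
      & certifies N' (C `&` sublevel a b) c gamma].
Proof.
move=> [_ [{}N {}C|{}N {}C C' D _ DD_D [[a [b [a_neq0 ->]]] CD] CC'] C'v].
  by left.
by right; exists N, D, a, b; split=> //; exists C'.
Qed.

Lemma cut_down_cp N C C' : cut_down N C C' ->
  exists (M : nat) (H : 'I_M -> set 'rV[R]_n) (D : 'I_M -> disjunction S),
    [/\ (M <= N)%N,
        forall i, DD (D i) /\ cutting_plane (cp_relaxation C H i) (D i) (H i)
      & cp_relaxation C H M = C'].
Proof.
elim=> [{}N {}C|].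
  exists 0%N, (fun=> setT), (fun i : 'I_0 => False_rect _ (notF (ltn_ord i))).
  split=> // [[]//|]; apply/seteqP; split=> x; first by case.
  by move=> Cx; split=> // -[].
move=> {}N {}C {}C' D0 H0 DD_D0 cut0 _ [M [H [D [MN DH CC']]]].
pose H' (i : 'I_M.+1) := oapp H H0 (unlift ord0 i).
have relaxS k : cp_relaxation C H' k.+1 = cp_relaxation (C `&` H0) H k.
  apply/seteqP; split=> x.
    move=> [Cx Hx]; split; first split=> //.
      by have := Hx ord0 isT; rewrite /H' unlift_none.
    by move=> j jk; have := Hx (lift ord0 j) jk; rewrite /H' liftK.
  move=> [[Cx H0x] Hx]; split=> // i; rewrite /H' /=.
  by case: unliftP => [j ->|_ _ //] jk; exact: Hx.
exists M.+1, H', (fun i => oapp D D0 (unlift ord0 i)); split=> //.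
  move=> i; rewrite /H'; case: unliftP => [j ->|->] /=.
    by rewrite relaxS.
  split=> //; rewrite (_ : cp_relaxation _ _ _ = C) //.
  by apply/seteqP; split=> x; [case | move=> Cx; split].
by rewrite relaxS.
Qed.

Lemma closed_disj_union (D : disjunction S) : closed (disj_union D).
Proof.
have := @pieces_closed _ _ _ D; rewrite /disj_union.
elim: (pieces D) => [_|Q qs IH qs_closed].
  rewrite (_ : mkset _ = set0); first exact: closed0.
  by apply/seteqP; split=> x // [].
rewrite (_ : mkset _ = Q `|` [set x | exists2 Q, Q \in qs & Q x]).
  apply: closedU; first by apply: qs_closed; rewrite inE eqxx.
  by apply: IH => P Pqs; apply: qs_closed; rewrite inE Pqs orbT.
apply/seteqP; split=> x /=.
  by move=> [P]; rewrite inE => /orP[/eqP ->|Pqs Px]; [left|right; exists P].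
by move=> [Qx|[P Pqs Px]]; [exists Q|exists P]; rewrite // inE ?eqxx ?Pqs ?orbT.
Qed.

(** Stability of certificates.  The first cut is relaxed by an [eta] so small
    that [K] cut by the relaxed halfspace stays in the neighbourhood [U]
    given by induction.  Being outside the disjunction or strictly inside the
    relaxed halfspace, and being in [U] or strictly outside that halfspace, are
    open conditions that hold on [K]; a set that satisfies them admits the
    relaxed cut and is led into [U] by it. *)
Lemma certifies_near N K c gamma eps : compact K -> 0 < eps ->
    certifies N K c gamma ->
  exists U, [/\ open U, K `<=` U &
    forall A, A `<=` U -> certifies N A c (gamma + eps)].
Proof.
move=> cK eps_gt0; elim: N K cK => [|N IH] K cK /certifiesP[Kv|].
1,3: exists [set x | dot c x < gamma + eps]; split;
  [ exact: strict_sublevel_open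
  | by move=> x /Kv cx; rewrite /= (le_lt_trans cx) // ltrDl
  | by move=> A Aeps; apply: certifies_valid => x /Aeps/ltW ].
  by move=> [N' [D [a [b []]]]].
move=> [_ [D [a [b [[<-] DD_D a_neq0 KD cert]]]]].
have [|U [oU KU UP]] := IH _ _ cert.
  by apply: compact_closedI => //; exact: sublevel_closed.
have [eta eta_gt0 KetaU] := relax_into_open cK oU KU.
exists ((~` disj_union D `|` [set x | dot a x < b + eta]) `&`
        (U `|` [set x | b + eta < dot a x])); split.
- apply: openI; apply: openU => //.
  + exact/closed_openC/closed_disj_union.
  + exact: strict_sublevel_open.
  + exact: strict_superlevel_open.
- move=> x Kx; split.
    have [Dx|nDx] := pselect (disj_union D x); last by left.
    by right; rewrite /= (le_lt_trans (KD x (conj Kx Dx))) // ltrDl.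
  have [ax|ax] := leP (dot a x) (b + eta); last by right.
  by left; apply: KetaU.
move=> A AV; apply: (certifies_cut (b := b + eta) DD_D a_neq0).
  by move=> x [/AV[[//|/ltW]]].
apply: UP => x [/AV[_ [//|]]]; rewrite /sublevel /= => lt_ax le_ax.
by have := lt_le_trans lt_ax le_ax; rewrite ltxx.
Qed.

End CutDown.

(** * Lifting cuts from a face *)

Section Lift.
Context {R : realType} {n : nat} {S : set 'rV[R]_n}.
Implicit Types (A : set 'rV[R]_n) (a c e x : 'rV[R]_n) (N : nat).

Definition polyhedral_pieces (D : disjunction S) : Prop :=
  forall Q, Q \in pieces D -> polyhedron Q.

(** The standing assumption under which cuts valid on a face of [A] lift to [A]
    at the cost of a slack [eps]; the slack may vanish only for polyhedra. *)
Definition liftable (eps : R) A : Prop :=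
  [/\ closed A, A `<=` @unit_cube R n, 0 <= eps & 0 < eps \/ polyhedron A].

Lemma liftable_sublevel eps A a b :
  liftable eps A -> liftable eps (A `&` sublevel a b).
Proof.
move=> [cA Acube eps_ge0 eps_poly]; split=> //.
- by apply: closedI => //; exact: sublevel_closed.
- by move=> x [/Acube].
- case: eps_poly => [|A_poly]; [by left | right].
  by apply: polyhedronI => //; exact: sublevel_polyhedron.
Qed.

Lemma liftable_half eps A : liftable eps A -> liftable (eps / 2) A.
Proof.
move=> [cA Acube eps_ge0 eps_poly]; split=> //; first by rewrite divr_ge0.
by case: eps_poly => [eps_gt0|]; [left; rewrite divr_gt0 | right].
Qed.

Lemma liftable_cut_down (DD : set (disjunction S)) N eps A A' :
  cut_down DD N A A' -> liftable eps A -> liftable eps A'.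
Proof.
elim=> [//|M B B' D H _ [[a [b [_ ->]]] _] _ IH] /liftable_sublevel lB.
exact/IH/lB.
Qed.

(** Each piece of the disjunction has its own multiplier; as [dot e] is at most
    [beta] on [A], a larger one works too, so their sum serves all pieces. *)
Lemma tilt_cut A (D : disjunction S) a b e beta eta :
    liftable eta A -> polyhedral_pieces D -> A `<=` sublevel e beta ->
    A `&` hyperplane e beta `&` disj_union D `<=` sublevel a b ->
  exists M0, forall M, M0 <= M ->
    A `&` disj_union D `<=` sublevel (a + M *: e) (b + eta + M * beta).
Proof.
move=> [cA Acube eta_ge0 eta_poly] D_poly Ae FDa.
suff [M0 M0_ge0 M0P] : exists2 M0, 0 <= M0 & forall M x, M0 <= M -> A x ->
    disj_union D x -> dot a x + M * (dot e x - beta) <= b + eta.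
  exists M0 => M MM0 x [Ax Dx]; rewrite /sublevel /= dotDl dotZl.
  by have := M0P M x MM0 Ax Dx; rewrite mulrBr; lra.
have tilt Q : Q \in pieces D -> exists2 M0, 0 <= M0 & forall M x, M0 <= M ->
    A x -> Q x -> dot a x + M * (dot e x - beta) <= b + eta.
  move=> QD.
  have AQe : A `&` Q `<=` sublevel e beta by move=> x [/Ae].
  have AQFa : A `&` Q `&` hyperplane e beta `<=` sublevel a b.
    by move=> x [[Ax Qx] ex]; apply: FDa; split=> //; exists Q.
  have AQcube : A `&` Q `<=` @unit_cube R n by move=> x [/Acube].
  case: eta_poly => [eta_gt0|A_poly].
    have cAQ : compact (A `&` Q).
      apply: closed_in_cube_compact => //; apply: closedI => //.
      exact: pieces_closed QD.
    have [M0 M0_ge0 M0P] := tilt_compact cAQ eta_gt0 AQe AQFa.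
    by exists M0 => // M x MM0 Ax Qx; exact: M0P.
  have AQ_poly := polyhedronI A_poly (D_poly Q QD).
  have [M0 M0_ge0 M0P] := tilt_polyhedron AQ_poly AQcube AQe AQFa.
  exists M0 => // M x MM0 Ax Qx.
  by apply: le_trans (M0P M x MM0 (conj Ax Qx)) _; rewrite lerDl.
rewrite /disj_union; elim: (pieces D) tilt => [|Q qs IH] tilt.
  by exists 0 => // M x _ _ [].
have [|M1 M1_ge0 M1P] := IH.
  by move=> P Pqs; apply: tilt; rewrite inE Pqs orbT.
have [|M2 M2_ge0 M2P] := tilt Q; first by rewrite inE eqxx.
exists (M1 + M2) => [|M x MM Ax [P]]; first exact: addr_ge0.
rewrite inE => /orP[/eqP ->|Pqs] Px.
  by apply: M2P => //; apply: le_trans MM; rewrite lerDr.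
apply: M1P => //; last by exists P.
by apply: le_trans MM; rewrite lerDl.
Qed.

(** Half of the slack pays for the first cut: by stability the remaining cuts
    on the face [F] still work after the first one has been relaxed by some
    [eta], and the relaxed cut is what the tilted cut leaves of the
    hyperplane.  The other half is for the induction.  On a polyhedron
    [eta = 0] will do. *)
Lemma lift_face (DD : set (disjunction S)) N A e beta c gamma eps :
    (forall D, DD D -> polyhedral_pieces D) -> liftable eps A ->
    e != 0 -> A `<=` sublevel e beta ->
    certifies DD N (A `&` hyperplane e beta) c gamma ->
  exists2 A', cut_down DD N A A' &
    valid_ineq c (gamma + eps) (A' `&` hyperplane e beta).
Proof.
move=> DD_poly + e_neq0.
elim: N A gamma eps => [|N IH] A gamma eps lA Ae /certifiesP[Fv|].
1,3: by case: lA => _ _ eps_ge0 _; exists A; [exact: cut_stop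
  | move=> x /Fv cx; rewrite (le_trans cx) ?lerDl].
  by move=> [N' [D [a [b []]]]].
move=> [_ [D [a [b [[<-] DD_D _ FDa cert]]]]].
pose F := A `&` hyperplane e beta.
have [cA Acube eps_ge0 eps_poly] := lA.
have cF : compact F.
  by apply: compact_closedI; [exact: closed_in_cube_compact | exact: hyperplane_closed].
have [eta [leta etaP]] : exists eta, liftable eta A /\
    forall L, L `<=` F `&` sublevel a (b + eta) ->
      certifies DD N L c (gamma + eps / 2).
  case: eps_poly => [eps_gt0|A_poly].
    have cFa : compact (F `&` sublevel a b).
      by apply: compact_closedI => //; exact: sublevel_closed.
    have eps2_gt0 : 0 < eps / 2 by rewrite divr_gt0.
    have [U [oU FU UP]] := certifies_near cFa eps2_gt0 cert.
    have [eta eta_gt0 FetaU] := relax_into_open cF oU FU.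
    exists eta; split; first by split=> //; [exact: ltW | left].
    by move=> L LF; apply: UP; exact: subset_trans FetaU.
  exists 0; split; first by split=> //; right.
  move=> L; rewrite addr0 => LF; apply: certifies_mono cert => //.
  by rewrite lerDl divr_ge0.
have [M0 M0P] := tilt_cut leta (DD_poly D DD_D) Ae FDa.
(* a halfspace needs a nonzero normal: a + M *: e vanishes for at most one M *)
have [M MM0 aMe_neq0] : exists2 M, M0 <= M & a + M *: e != 0.
  have [aM0|] := eqVneq (a + M0 *: e) 0; last by exists M0.
  exists (M0 + 1); first by rewrite lerDl.
  by rewrite scalerDl scale1r addrA aM0 add0r.
pose H' := sublevel (a + M *: e) (b + eta + M * beta).
have AH'F : A `&` H' `&` hyperplane e beta `<=` F `&` sublevel a (b + eta).
  move=> x [[Ax]]; rewrite /H' /sublevel /hyperplane /= dotDl dotZl => H'x ex.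
  by split; [split | rewrite ex in H'x; lra].
have [||A' AA' A'v] := IH (A `&` H') (gamma + eps / 2) (eps / 2)
    (liftable_sublevel _ _ (liftable_half lA)).
- by move=> x [/Ae].
- exact: etaP.
exists A'; last by move: A'v; rewrite -addrA -splitr.
apply: (cut_step DD_D _ AA'); split; last exact: M0P.
by exists (a + M *: e), (b + eta + M * beta).
Qed.

End Lift.

(** * From branch-and-cut trees to cutting planes *)

Section Tree.
Context {R : realType} {n : nat}.
Implicit Types (A : set 'rV[R]_n) (c x : 'rV[R]_n) (N : nat) (t : bc_tree R n).
Local Notation DD := (@variable_disjunctions R n).

Lemma var_disjunctions_polyhedral (D : disjunction (@integer_points R n)) :
  DD D -> polyhedral_pieces D.
Proof.
move=> [i [K ->]] Q; rewrite !inE => /orP[]/eqP ->.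
- by rewrite le_coordE; exact: sublevel_polyhedron.
- by rewrite ge_coordE; exact: sublevel_polyhedron.
Qed.

Lemma disj_union_var0 (i : 'I_n) x : disj_union (var_disjunction R i 0) x ->
  x ord0 i <= 0 \/ 1 <= x ord0 i.
Proof.
by move=> [Q]; rewrite !inE => /orP[]/eqP -> /=; rewrite ?add0r; [left|right].
Qed.

(** The inequality itself is the cut, unless [c = 0].  In that case, if
    [gamma < 0] then [A] misses the disjunction, so any halfspace is a valid
    cut; [x_i <= 0] is one contained in the disjunction, and leaves nothing
    of [A]. *)
Lemma certifies_of_faces N A (i : 'I_n) c gamma :
    valid_ineq c gamma (A `&` disj_union (var_disjunction R i 0)) ->
  certifies DD N.+1 A c gamma.
Proof.
move=> v.
have DDi : DD (var_disjunction R i 0) by exists i, 0.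
have [c0|c_neq0] := eqVneq c 0; last first.
  by apply: (certifies_cut DDi c_neq0 v); apply: certifies_valid => x [].
have [gamma_ge0|gamma_lt0] := leP 0 gamma.
  by apply: certifies_valid => x _; rewrite c0 dot0l.
have AD0 x : A x -> ~ disj_union (var_disjunction R i 0) x.
  move=> Ax Dx; have := v x (conj Ax Dx).
  by rewrite c0 dot0l leNgt gamma_lt0.
apply: (certifies_cut (b := 0) DDi (delta_neq0 i)); first by move=> x [/AD0].
apply: certifies_valid => x [/AD0 nDx]; rewrite -le_coordE => xi; case: nDx.
by exists [set x : 'rV[R]_n | x ord0 i <= 0] => //; rewrite !inE eqxx.
Qed.

(** Lifting the second proof starts from the set left by the first one; its
    face is smaller than that of [A], so the second proof still applies. *)
Lemma branch_step N1 N2 A (i : 'I_n) c gamma eps : liftable eps A ->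
    certifies DD N1 (A `&` [set x | x ord0 i <= 0]) c gamma ->
    certifies DD N2 (A `&` [set x | 1 <= x ord0 i]) c gamma ->
  certifies DD (N1 + N2).+1 A c (gamma + eps).
Proof.
move=> lA cert0 cert1.
have [_ Acube _ _] := lA.
have [|||A1 AA1 A1v] := lift_face (N := N1) (e := - delta_mx 0 i) (beta := 0)
    (c := c) (gamma := gamma) var_disjunctions_polyhedral lA.
- by rewrite oppr_eq0; exact: delta_neq0.
- move=> x /Acube/(_ i)/andP[xi _].
  by rewrite /sublevel /= dotNl dot_delta oppr_le0.
- apply: certifies_mono cert0 => // x [Ax]; rewrite /hyperplane /= dotNl dot_delta.
  by move=> /eqP; rewrite oppr_eq0 => /eqP ->; split=> /=.
have A1A := cut_down_sub AA1.
have [|||A2 A12 A2v] := lift_face (N := N2) (e := delta_mx 0 i) (beta := 1)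
    (c := c) (gamma := gamma) var_disjunctions_polyhedral
    (liftable_cut_down AA1 lA).
- exact: delta_neq0.
- by move=> x /A1A/Acube/(_ i)/andP[_]; rewrite /sublevel /= dot_delta.
- apply: certifies_mono cert1 => // x [/A1A Ax]; rewrite /hyperplane /= dot_delta.
  by move=> ->; split=> /=.
have [A' A2A' A'v] : certifies DD 1 A2 c (gamma + eps).
  apply: (@certifies_of_faces 0 A2 i) => x [A2x /disj_union_var0].
  have A1x := cut_down_sub A12 A2x; have /(_ i)/andP[x0 x1] := Acube _ (A1A _ A1x).
  move=> [xi|xi].
    by apply: A1v; split=> //; rewrite /hyperplane /= dotNl dot_delta; lra.
  by apply: A2v; split=> //; rewrite /hyperplane /= dot_delta; lra.
exists A' => //.
by have := cut_down_trans AA1 (cut_down_trans A12 A2A'); rewrite addn1 addnS.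
Qed.

Lemma bc_nodes_gt0 t : (0 < size (bc_nodes t))%N.
Proof. by case: t. Qed.

(** Induction on the number of nodes, since trees are nested in lists.  A
    branching spends half of the slack on its subtrees and half on lifting
    their proofs. *)
Lemma bc_certifies t c gamma eps : liftable eps (root_set t) -> bc_steps DD t ->
    (forall A, A \in bc_leaves t -> valid_ineq c gamma A) ->
  certifies DD (bc_size t) (root_set t) c (gamma + eps).
Proof.
have [m] := ubnP (size (bc_nodes t)).
elim: m t eps => // m IH [A|A t|A ts] eps + /= lA.
- move=> _ _ leaves; apply: certifies_valid => x /leaves.
  rewrite inE eqxx => /(_ isT) cx; rewrite (le_trans cx) // lerDl.
  by case: lA.
- rewrite ltnS => tm [[D [H [DD_D cutH tE]]] t_steps] leaves.
  have [a [b [_ HE]]] := cutH.1.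
  have [|A' tA' A'v] := IH t eps tm _ t_steps leaves.
    by rewrite tE HE; exact: liftable_sublevel.
  rewrite tE in tA'; exists A' => //.
  rewrite /bc_size /= -(prednK (bc_nodes_gt0 t)).
  exact: cut_step DD_D cutH tA'.
move=> tsm [[D [[i [K ->]] tsE]]] steps leaves.
case: ts tsm tsE steps leaves => [|t1 [|t2 [|t3 ts]]] //= tsm [t1E t2E].
rewrite cats0 in tsm *; rewrite size_cat in tsm.
move=> [t1_steps [t2_steps _]] leaves.
have sz : bc_size (Branching A [:: t1; t2]) = (bc_size t1 + bc_size t2).+2.
  rewrite /bc_size /= cats0 size_cat.
  by move: (bc_nodes_gt0 t1) (bc_nodes_gt0 t2); lia.
have cert1 eps' : liftable eps' A ->
    certifies DD (bc_size t1) (root_set t1) c (gamma + eps').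
  move=> lA'; apply: IH => //.
  - by move: (bc_nodes_gt0 t2) tsm; lia.
  - by rewrite t1E le_coordE; exact: liftable_sublevel.
  - by move=> B Bt; apply: leaves; rewrite mem_cat Bt.
have cert2 eps' : liftable eps' A ->
    certifies DD (bc_size t2) (root_set t2) c (gamma + eps').
  move=> lA'; apply: IH => //.
  - by move: (bc_nodes_gt0 t1) tsm; lia.
  - by rewrite t2E ge_coordE; exact: liftable_sublevel.
  - by move=> B Bt; apply: leaves; rewrite mem_cat cats0 Bt orbT.
have [_ Acube _ _] := lA.
rewrite sz; have [K_lt0|K_gt0|K0] := ltgtP K 0.
- apply: certifies_mono (cert2 _ lA) => //; first by lia.
  rewrite t2E => x Ax; split=> //=; have /andP[xi _] := Acube x Ax i.
  by apply: le_trans xi; rewrite lerz0; lia.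
- apply: certifies_mono (cert1 _ lA) => //; first by lia.
  rewrite t1E => x Ax; split=> //=; have /andP[_ xi] := Acube x Ax i.
  by apply: (le_trans xi); rewrite ler1z; lia.
have lA2 := liftable_half lA.
have := cert1 _ lA2; have := cert2 _ lA2.
rewrite t1E t2E K0 add0r => cert_ge1 cert_le0.
have := branch_step lA2 cert_le0 cert_ge1.
by rewrite -addrA -splitr; apply: certifies_mono.
Qed.

End Tree.

Theorem theorem2p1 (R : realType) (n : nat) (C : set 'rV[R]_n)
    (C_closed : closed C) (C_convex : @convex_set R 'rV[R]_n C)
    (C_cube : C `<=` @unit_cube R n)
    (c : 'rV[R]_n) (gamma : R)
    (c_valid : valid_ineq c gamma (C `&` @binary_points R n)) (N : nat)
    (has_bc : exists t : bc_tree R n,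
       bc_proof (@variable_disjunctions R n) C c gamma t /\ bc_size t = N) :
  (forall eps : R, 0 < eps ->
     exists (M : nat) (H : 'I_M -> set 'rV[R]_n),
       (M <= N)%N /\
       cp_proof (@variable_disjunctions R n) C c (gamma + eps) H) /\
  (polytope C ->
     exists (M : nat) (H : 'I_M -> set 'rV[R]_n),
       (M <= N)%N /\
       cp_proof (@variable_disjunctions R n) C c gamma H).
Proof.
have [t [[C_valid tC _ t_steps t_leaves] <-]] := has_bc.
suff cp eps : liftable eps C ->
    exists (M : nat) (H : 'I_M -> set 'rV[R]_n),
      (M <= bc_size t)%N /\
      cp_proof (@variable_disjunctions R n) C c (gamma + eps) H.
  split=> [eps eps_gt0|[C_poly _]].
    by apply: cp; split=> //; [exact: ltW | left].
  by rewrite -[gamma]addr0; apply: cp; split=> //; right.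
move=> lC; have := bc_certifies (t := t) (eps := eps) _ t_steps t_leaves.
rewrite tC => /(_ lC)[C' /cut_down_cp[M [H [D [MN DH CC']]]] C'v].
exists M, H; split=> //; split; [|by exists D|by rewrite CC'].
by move=> x /C_valid cx; rewrite (le_trans cx) // lerDl; case: lC.
Qed.
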